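(* Let $\gamma=0$ and $d=0$. For any length $2L$ of the inhomogeneity ($L>0$) there is a unique pinned fluxon, for which the Hamiltonian inside the inhomogeneity has the value $h=h(L)\in(0,2)$ given implicitly by \[ L=\frac{\pi-\arccos(1-h)}{\sqrt{2h}} . \] With $\phi_{\rm in}=\arccos(1-h)$, define $x^*$ to be the shift such that $\phi_0(-L+x^* )=\phi_{\rm in}$, where $\phi_0(\xi)=4\arctan(e^\xi)$. Then the pinned fluxon is given explicitly by \[ \phi_{\rm pin}(x;L,0,0)=\begin{cases}\phi_0(x+x^* ),& x<-L,\\[1mm] \pi+\dfrac{\pi-\arccos(1-h)}{L}\,x,& |x|<L,\\[1mm] \phi_0(x-x^* ),& x>L.\end{cases} \]
   Context: For $L>0$ let $D(x;L,d)=d$ for $|x|<L$ and $D(x;L,d)=1$ for $|x|>L$. A pinned fluxon for parameters $(L,\gamma,d)$ is a function $\phi\in C^1(\mathbb R)$, twice differentiable for $|x|\ne L$, with $\phi_{xx}-D(x;L,d)\sin\phi+\gamma=0$ for $|x|\ne L$, $\lim_{x\to-\infty}\phi(x)=\arcsin\gamma$ and $\lim_{x\to\infty}\phi(x)=\arcsin\gamma+2\pi$; it is denoted $\phi_{\rm pin}(x;L,\gamma,d)$. The Hamiltonian is $H=\frac12\phi_x^2-D(x;L,d)(1-\cos\phi)+\gamma\phi$, which is constant on $|x|<L$; for $\gamma=d=0$ its value inside the inhomogeneity is $h=\frac12\phi_x^2$. *)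

(* Defs.v *)
(* Stdlib real numbers, with Coquelicot for limits and derivatives. *)
From Stdlib Require Import Reals.
From Coquelicot Require Import Coquelicot.
Open Scope R_scope.

(* The value at |x| = L, where the inhomogeneity is left undefined
   mathematically, is an arbitrary choice: D is only ever used for |x| <> L. *)
Definition D (x L d : R) : R := if Rlt_dec (Rabs x) L then d else 1.

Definition pinned_fluxon (L gamma d : R) (phi : R -> R) : Prop :=
  (forall x, ex_derive phi x) /\
  (forall x, continuous (Derive phi) x) /\
  (forall x, Rabs x <> L ->
     ex_derive_n phi 2 x /\
     Derive_n phi 2 x - D x L d * sin (phi x) + gamma = 0) /\
  is_lim phi m_infty (asin gamma) /\
  is_lim phi p_infty (asin gamma + 2 * PI).

Definition hamiltonian (L gamma d : R) (phi : R -> R) (x : R) : R :=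
  / 2 * (Derive phi x) ^ 2 - D x L d * (1 - cos (phi x)) + gamma * phi x.

Definition phi0 (xi : R) : R := 4 * atan (exp xi).

(* Main.v *)
Require Import Defs.
From Stdlib Require Import Reals Lra FunctionalExtensionality.
From Coquelicot Require Import Coquelicot.
Open Scope R_scope.

(* Outside the inhomogeneity [phi'' = sin phi], and the limits at infinity force
   zero energy there: [phi'^2 = 4 sin^2 (phi / 2)]. Every solution with such
   Cauchy data is, up to translation and a multiple of [2 PI], [0], [phi0] or
   [- phi0], so each tail is determined by its limit and its endpoint value.
   Inside, [phi] is affine. Equality of the slopes at [-L] and [L] gives
   [phi (- L) = p] and [phi L = 2 PI - p], where [PI - p = 2 L sin (p / 2)];
   this equation has a unique root in [(0, PI)], and [h = 1 - cos p]. *)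

(** * Mean value tools and uniqueness for the pendulum equation *)

Lemma mean_value (f df : R -> R) (a b : R) :
  a < b ->
  (forall x, a < x < b -> is_derive f x (df x)) ->
  (forall x, a <= x <= b -> continuous f x) ->
  exists c, a < c < b /\ f b - f a = df c * (b - a).
Proof.
intros Hab Hd Hc.
assert (prf : forall c, a < c < b -> derivable_pt f c).
{ intros c Hc'. exists (df c). apply is_derive_Reals, Hd, Hc'. }
assert (pri : forall c, a < c < b -> derivable_pt id c).
{ intros c _. apply derivable_pt_id. }
destruct (MVT f id a b prf pri Hab) as [c [P E]].
- intros c Hc'. apply continuity_pt_filterlim, Hc, Hc'.
- intros c _. apply derivable_continuous_pt, derivable_pt_id.
- exists c. split; [exact P|].
  rewrite (Derive_Reals f c (prf c P)), (Derive_Reals id c (pri c P)) in E.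
  replace (Derive f c) with (df c) in E by (symmetry; apply is_derive_unique, Hd, P).
  replace (Derive id c) with 1 in E by (symmetry; apply Derive_id).
  unfold id in E. lra.
Qed.

Lemma constant_of_derive_zero (f : R -> R) (a b : R) :
  a <= b ->
  (forall x, a < x < b -> is_derive f x 0) ->
  (forall x, a <= x <= b -> continuous f x) ->
  f a = f b.
Proof.
intros Hab Hd Hc. destruct (Rle_lt_or_eq_dec a b Hab) as [H| <- ]; [|reflexivity].
destruct (mean_value f (fun _ => 0) a b H Hd Hc) as [c [_ E]]. lra.
Qed.

Lemma sin_lipschitz (a b : R) : Rabs (sin a - sin b) <= Rabs (a - b).
Proof.
destruct (MVT_gen sin b a cos) as [c [_ E]].
- intros x _. apply is_derive_Reals, derivable_pt_lim_sin.
- intros x _. apply continuity_sin.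
- rewrite E, Rabs_mult.
  assert (H := COS_bound c). assert (Hc : Rabs (cos c) <= 1) by (apply Rabs_le; lra).
  assert (H' := Rabs_pos (a - b)). nra.
Qed.

Lemma continuous_of_derive (f : R -> R) (x l : R) : is_derive f x l -> continuous f x.
Proof. intro H. apply (ex_derive_continuous (V := R_NormedModule) f). now exists l. Qed.

(* With [E = (f - g)^2 + (f1 - g1)^2] the Lipschitz bound on [sin] gives
   [|E'| <= 2 E], so [E exp (2 x)] is nondecreasing and vanishes at [c]. *)
Lemma pendulum_unique_left (f f1 g g1 : R -> R) (c : R) :
  (forall x, x < c -> is_derive f x (f1 x) /\ is_derive f1 x (sin (f x))) ->
  (forall x, x < c -> is_derive g x (g1 x) /\ is_derive g1 x (sin (g x))) ->
  continuous f c -> continuous f1 c -> continuous g c -> continuous g1 c ->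
  f c = g c -> f1 c = g1 c ->
  forall x, x <= c -> f x = g x.
Proof.
intros Hf Hg Cf Cf1 Cg Cg1 E0 E1 x Hx.
destruct (Rle_lt_or_eq_dec x c Hx) as [Hxc| -> ]; [|assumption].
set (E := fun y => ((f y - g y) ^ 2 + (f1 y - g1 y) ^ 2) * exp (2 * y)).
set (dE := fun y => (2 * (f y - g y) * (f1 y - g1 y)
   + 2 * (f1 y - g1 y) * (sin (f y) - sin (g y))
   + 2 * ((f y - g y) ^ 2 + (f1 y - g1 y) ^ 2)) * exp (2 * y)).
assert (DE : forall y, y < c -> is_derive E y (dE y)).
{ intros y Hy. destruct (Hf y Hy) as [F F1]. destruct (Hg y Hy) as [G G1].
  unfold E, dE. auto_derive.
  - repeat split; eexists; eassumption.
  - replace (Derive (fun x => f x) y) with (f1 y) by (symmetry; now apply is_derive_unique).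
    replace (Derive (fun x => f1 x) y) with (sin (f y)) by (symmetry; now apply is_derive_unique).
    replace (Derive (fun x => g x) y) with (g1 y) by (symmetry; now apply is_derive_unique).
    replace (Derive (fun x => g1 x) y) with (sin (g y)) by (symmetry; now apply is_derive_unique).
    ring. }
destruct (mean_value E dE x c Hxc) as [z [Hz M]].
- intros y Hy. apply DE. lra.
- intros y Hy. destruct (Rle_lt_or_eq_dec y c (proj2 Hy)) as [Hy'| -> ].
  + eapply continuous_of_derive. now apply DE.
  + apply (continuous_mult (fun y => (f y - g y) ^ 2 + (f1 y - g1 y) ^ 2) (fun y => exp (2 * y))).
    * apply (continuous_plus (fun y => (f y - g y) ^ 2) (fun y => (f1 y - g1 y) ^ 2)).
      -- apply (continuous_comp (fun y => f y - g y) (fun u => u ^ 2)).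
         ++ now apply (continuous_minus f g).
         ++ apply (ex_derive_continuous (V := R_NormedModule)). now auto_derive.
      -- apply (continuous_comp (fun y => f1 y - g1 y) (fun u => u ^ 2)).
         ++ now apply (continuous_minus f1 g1).
         ++ apply (ex_derive_continuous (V := R_NormedModule)). now auto_derive.
    * apply (ex_derive_continuous (V := R_NormedModule)). now auto_derive.
- assert (Pos : 0 <= dE z).
  { unfold dE. apply Rmult_le_pos; [|apply Rlt_le, exp_pos].
    assert (H := sin_lipschitz (f z) (g z)).
    set (u := f z - g z) in *. set (v := f1 z - g1 z).
    set (s := sin (f z) - sin (g z)) in *.
    assert (S : s ^ 2 <= u ^ 2).
    { rewrite <- !(pow2_abs s), <- (pow2_abs u). apply pow_incr.
      split; [apply Rabs_pos|assumption]. }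
    (* The bracket [2uv + 2vs + 2(u^2 + v^2)] equals [(u + v)^2 + (v + s)^2 + (u^2 - s^2)], and each
       term is nonnegative. *)
    assert (0 <= (u + v) ^ 2) by apply pow2_ge_0. assert (0 <= (v + s) ^ 2) by apply pow2_ge_0. nra. }
  assert (Ec : E c = 0) by (unfold E; rewrite E0, E1; ring).
  assert (Ex : E x <= 0) by nra.
  unfold E in Ex. assert (P := exp_pos (2 * x)).
  assert (N : (f x - g x) ^ 2 + (f1 x - g1 x) ^ 2 <= 0) by nra.
  assert (V := pow2_ge_0 (f1 x - g1 x)).
  assert (Z : f x - g x = 0) by nra. lra.
Qed.

(** * The kink [phi0] *)

Lemma phi0_bound (x : R) : 0 < phi0 x < 2 * PI.
Proof.
unfold phi0. assert (H := atan_bound (exp x)).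
assert (H' := atan_increasing 0 (exp x) (exp_pos x)). rewrite atan_0 in H'. lra.
Qed.

Lemma phi0_increasing (x y : R) : x < y -> phi0 x < phi0 y.
Proof.
intro H. unfold phi0. assert (H' := atan_increasing _ _ (exp_increasing _ _ H)). lra.
Qed.

Lemma phi0_injective (x y : R) : phi0 x = phi0 y -> x = y.
Proof.
intro H. destruct (Rtotal_order x y) as [h|[h|h]]; [|assumption|];
  apply phi0_increasing in h; lra.
Qed.

Lemma phi0_surjective (r : R) : 0 < r < 2 * PI -> exists s, phi0 s = r.
Proof.
intro H. exists (ln (tan (r / 4))). unfold phi0.
rewrite exp_ln by (apply tan_gt_0; lra).
rewrite atan_tan by lra. lra.
Qed.

(** With [y = exp x], both the derivative and [2 * sin (2 * atan y)] equal [4 y / (1 + y^2)]. This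
    is the first-order equation of zero energy, giving the slope as a function of the value. *)
Lemma is_derive_phi0 (x : R) : is_derive phi0 x (2 * sin (phi0 x / 2)).
Proof.
assert (P := exp_pos x).
evar_last.
- unfold phi0. auto_derive; [exact I|reflexivity].
- unfold phi0. replace (4 * atan (exp x) / 2) with (2 * atan (exp x)) by field.
  rewrite sin_2a, sin_atan, cos_atan.
  set (q := sqrt (1 + (exp x)²)).
  assert (Q : q * q = 1 + exp x * exp x) by (apply sqrt_sqrt; unfold Rsqr; nra).
  assert (q <> 0) by (intro Z; rewrite Z in Q; nra).
  field_simplify; [|assumption|try nra].
  replace (q ^ 2) with (1 + exp x ^ 2) by (simpl; lra).
  field; nra.
Qed.

(** Comes from [atan (/ y) = PI / 2 - atan y]; this symmetry transfers facts about the left tail to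
    the right one. *)
Lemma phi0_opp (x : R) : phi0 (- x) = 2 * PI - phi0 x.
Proof.
unfold phi0. rewrite exp_Ropp, atan_inv by apply exp_pos. field.
Qed.

Lemma is_lim_phi0_m (t : R) : is_lim (fun x => phi0 (x + t)) m_infty 0.
Proof.
(* As a function of [u = exp x], the shifted kink is continuous at [u = 0], the limit of [exp] at
   minus infinity. *)
replace 0 with (4 * atan (exp t * 0)) by (rewrite Rmult_0_r, atan_0; ring).
apply is_lim_ext with (fun x => (fun u => 4 * atan (exp t * u)) (exp x)).
- intro y. unfold phi0. rewrite exp_plus. do 2 f_equal. ring.
- apply (is_lim_comp_continuous exp (fun u => 4 * atan (exp t * u)) m_infty 0).
  + apply is_lim_exp_m.
  + apply (ex_derive_continuous (V := R_NormedModule)). now auto_derive.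
Qed.

(** * Zero-energy tails *)

(** The left side is [2 * (1 - cos y)], the potential term of the energy up to a factor; the bound
    makes it small where [phi] is small. *)
Lemma sin_sqr_le (y : R) : (2 * sin (y / 2)) ^ 2 <= y ^ 2.
Proof.
assert (H := sin_lipschitz (y / 2) 0). rewrite sin_0, !Rminus_0_r in H.
assert (S : sin (y / 2) ^ 2 <= (y / 2) ^ 2).
{ rewrite <- (pow2_abs (sin _)), <- (pow2_abs (y / 2)). apply pow_incr.
  split; [apply Rabs_pos|assumption]. }
nra.
Qed.

(* The energy [d^2 / 2 - (1 - cos phi)] is constant, and it vanishes because by
   the mean value theorem [d] is arbitrarily small somewhere near [-infinity]. *)
Lemma tail_energy (phi d : R -> R) (c : R) :
  (forall x, is_derive phi x (d x)) ->
  (forall x, continuous d x) ->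
  (forall x, x < c -> is_derive d x (sin (phi x))) ->
  is_lim phi m_infty 0 ->
  d c ^ 2 = (2 * sin (phi c / 2)) ^ 2.
Proof.
intros Hp Hc Hd Hl.
(* Twice the energy, since [1 - cos y = 2 sin^2 (y / 2)]. *)
set (e := fun x => d x ^ 2 - (2 * sin (phi x / 2)) ^ 2).
assert (Const : forall x, x <= c -> e x = e c).
{ intros x Hx. apply constant_of_derive_zero; [assumption| |].
  - intros y Hy. unfold e. auto_derive.
    + repeat split; eexists; [apply Hd|apply Hp]; lra.
    + replace (Derive (fun x => d x) y) with (sin (phi y))
        by (symmetry; apply is_derive_unique, Hd; lra).
      replace (Derive (fun x => phi x) y) with (d y)
        by (symmetry; apply is_derive_unique, Hp).
      replace (sin (phi y)) with (sin (2 * (phi y / 2))) by (f_equal; field).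
      rewrite sin_2a. unfold Rdiv. field.
  - intros y _. unfold e.
    apply (continuous_minus (fun x => d x ^ 2) (fun x => (2 * sin (phi x / 2)) ^ 2)).
    + apply (continuous_comp d (fun u => u ^ 2)); [apply Hc|].
      apply (ex_derive_continuous (V := R_NormedModule)). now auto_derive.
    + apply (continuous_comp phi (fun u => (2 * sin (u / 2)) ^ 2)).
      * eapply continuous_of_derive, Hp.
      * apply (ex_derive_continuous (V := R_NormedModule)). now auto_derive. }
assert (Small : forall eps, 0 < eps < 1 -> Rabs (e c) <= 4 * eps).
{ intros eps He.
  apply is_lim_spec in Hl. destruct (Hl (mkposreal eps (proj1 He))) as [M HM]. simpl in HM.
  set (b := Rmin c M - 1).
  assert (b < c /\ b < M) as [Bc BM]
    by (unfold b; assert (H := Rmin_l c M); assert (H' := Rmin_r c M); lra).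
  (* On an interval of length 1 where [|phi| < eps], some slope [d z] equals the increment of [phi],
     hence is below [2 * eps] in absolute value. *)
  destruct (mean_value phi d (b - 1) b) as [z [Hz E]].
  - lra.
  - intros; apply Hp.
  - intros; eapply continuous_of_derive, Hp.
  - rewrite <- (Const z) by lra.
    assert (A1 := HM b BM). assert (A2 := HM (b - 1) ltac:(lra)).
    assert (A3 := HM z ltac:(lra)).
    rewrite Rminus_0_r in A1, A2, A3.
    apply Rabs_def2 in A1, A2, A3.
    assert (Dz : d z ^ 2 <= 4 * eps) by nra.
    assert (Sz := sin_sqr_le (phi z)).
    assert (Pz : phi z ^ 2 <= 4 * eps) by nra.
    assert (D0 := pow2_ge_0 (d z)). assert (S0 := pow2_ge_0 (2 * sin (phi z / 2))).
    unfold e. apply Rabs_le. lra. }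
assert (Z : e c = 0).
{ destruct (Req_dec (e c) 0) as [|N]; [assumption|exfalso].
  apply Rabs_pos_lt in N. set (k := Rabs (e c)) in *.
  (* The bound [k / 8] yields [k <= k / 2], a contradiction; [1 / 2] keeps [eps] below 1. *)
  assert (H := Small (Rmin (1 / 2) (k / 8))).
  assert (H' := Rmin_r (1 / 2) (k / 8)). assert (H'' := Rmin_l (1 / 2) (k / 8)).
  assert (0 < Rmin (1 / 2) (k / 8)) by (apply Rmin_glb_lt; lra).
  lra. }
unfold e in Z. lra.
Qed.

(** The values 0, 1 and -1 stand for the constant, the kink and the antikink. *)
Definition sign_value (s : R) : Prop := s = 0 \/ s = 1 \/ s = -1.

(** Reduce [p] modulo [2 * PI]: a zero remainder is the constant case, any other is a value of
    [phi0], and the sign of [b] selects kink or antikink. The condition [sin (M / 2) = 0] encodes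
    that [M] is a multiple of [2 * PI]. *)
Lemma separatrix_data (p b : R) :
  b ^ 2 = (2 * sin (p / 2)) ^ 2 ->
  exists M s t, sign_value s /\ sin (M / 2) = 0 /\
    p = M + s * phi0 t /\ b = s * (2 * sin (phi0 t / 2)).
Proof.
intro H. assert (PP := PI_RGT_0).
set (k := Int_part (p / (2 * PI))).
destruct (base_Int_part (p / (2 * PI))) as [K1 K2]. fold k in K1, K2.
set (M := IZR k * PI * 2).
assert (SM : sin (M / 2) = 0).
{ apply sin_eq_0_1. exists k. unfold M. field. }
assert (Q : p / (2 * PI) * (2 * PI) = p) by (field; lra).
assert (B : 0 <= p - M < 2 * PI) by (unfold M; nra).
destruct (Rle_lt_or_eq_dec _ _ (proj1 B)) as [Pos|Zero].
- destruct (phi0_surjective (p - M) (conj Pos (proj2 B))) as [t Ht].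
  assert (C2 : cos (M / 2) ^ 2 = 1).
  { assert (E := sin2_cos2 (M / 2)). unfold Rsqr in E. rewrite SM in E. nra. }
  assert (S : (2 * sin (p / 2)) ^ 2 = (2 * sin (phi0 t / 2)) ^ 2).
  { replace (p / 2) with (M / 2 + phi0 t / 2) by (rewrite Ht; field).
    rewrite sin_plus, SM. nra. }
  rewrite S in H. set (w := 2 * sin (phi0 t / 2)) in *.
  assert (F : (b - w) * (b + w) = 0) by lra.
  apply Rmult_integral in F. destruct F as [F|F].
  + exists M, 1, t. unfold sign_value. repeat split; [auto|assumption|lra|fold w; lra].
  (* By reflection [M + phi0 t = (M + 2 * PI) - phi0 (- t)], so the same value is reached on a
     descending branch. *)
  + exists (M + 2 * PI), (-1), (- t).
    assert (W : 2 * sin (phi0 (- t) / 2) = w).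
    { unfold w. rewrite phi0_opp.
      replace ((2 * PI - phi0 t) / 2) with (PI - phi0 t / 2) by field.
      now rewrite sin_PI_x. }
    rewrite W. unfold sign_value. repeat split; [auto| |rewrite phi0_opp; lra|lra].
    replace ((M + 2 * PI) / 2) with (M / 2 + PI) by field.
    rewrite neg_sin. lra.
- exists M, 0, 0. unfold sign_value. repeat split; [auto|assumption|lra|].
  replace (p / 2) with (M / 2) in H by lra. rewrite SM in H. nra.
Qed.

(** Differentiating [2 sin (phi0 / 2)] gives [2 sin (phi0 / 2) cos (phi0 / 2) = sin phi0]; [M] drops
    out by periodicity, and [s] passes through [sin] by oddness. *)
Lemma separatrix_pendulum (M s t x : R) :
  sign_value s -> sin (M / 2) = 0 ->
  is_derive (fun x => M + s * phi0 (x + t)) x (s * (2 * sin (phi0 (x + t) / 2))) /\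
  is_derive (fun x => s * (2 * sin (phi0 (x + t) / 2))) x
    (sin (M + s * phi0 (x + t))).
Proof.
intros Hs SM.
assert (D := is_derive_phi0 (x + t)).
assert (E : ex_derive phi0 (x + t)) by (eexists; exact D).
assert (V : Derive (fun x => phi0 x) (x + t) = 2 * sin (phi0 (x + t) / 2))
  by now apply is_derive_unique.
split.
- auto_derive; [easy|]. rewrite V. ring.
- auto_derive; [easy|]. rewrite V.
  assert (SM' : sin M = 0).
  { replace M with (2 * (M / 2)) by field. rewrite sin_2a, SM. ring. }
  assert (CM : cos M = 1).
  { replace M with (2 * (M / 2)) by field. rewrite cos_2a_sin, SM. ring. }
  rewrite sin_plus, SM', CM.
  assert (P : sin (phi0 (x + t)) = 2 * sin (phi0 (x + t) / 2) * cos (phi0 (x + t) / 2)).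
  { rewrite <- sin_2a. f_equal. field. }
  destruct Hs as [->|[->| ->]].
  + rewrite !Rmult_0_l, sin_0. ring.
  + rewrite !Rmult_1_l, P. unfold Rdiv. field.
  + replace (-1 * phi0 (x + t)) with (- phi0 (x + t)) by ring.
    rewrite sin_neg, P. unfold Rdiv. field.
Qed.

(** The separatrix with the Cauchy data of [phi] at [c] coincides with [phi] up to [c] by
    uniqueness, and the limit at minus infinity forces [M = 0]. A positive endpoint value leaves
    only [s = 1]. *)
Lemma left_tail (phi d : R -> R) (c : R) :
  (forall x, is_derive phi x (d x)) ->
  (forall x, continuous d x) ->
  (forall x, x < c -> is_derive d x (sin (phi x))) ->
  is_lim phi m_infty 0 ->
  - 2 * PI < phi c < 2 * PI /\ d c = 2 * sin (phi c / 2) /\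
  (0 < phi c -> exists t, forall x, x <= c -> phi x = phi0 (x + t)).
Proof.
intros Hp Hc Hd Hl.
destruct (separatrix_data (phi c) (d c)) as (M & s & t & Hs & SM & P & B).
{ now apply tail_energy. }
assert (Eq : forall x, x <= c -> phi x = M + s * phi0 (x + (t - c))).
{ assert (T : c + (t - c) = t) by ring.
  apply (pendulum_unique_left phi d
    (fun x => M + s * phi0 (x + (t - c)))
    (fun x => s * (2 * sin (phi0 (x + (t - c)) / 2)))).
  - intros x Hx. split; [apply Hp|now apply Hd].
  - intros x _. now apply separatrix_pendulum.
  - eapply continuous_of_derive, Hp.
  - apply Hc.
  - eapply continuous_of_derive. now apply separatrix_pendulum.
  - eapply continuous_of_derive. now apply (separatrix_pendulum M).
  - now rewrite T.
  - now rewrite T. }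
assert (M0 : M = 0).
{ assert (L : is_lim phi m_infty M).
  { apply is_lim_ext_loc with (fun x => M + s * phi0 (x + (t - c))).
    - exists c. intros x Hx. symmetry. apply Eq. lra.
    - replace (Finite M) with (Finite (M + s * 0)) by (f_equal; ring).
      apply (is_lim_comp_continuous (fun x => phi0 (x + (t - c))) (fun u => M + s * u) m_infty 0).
      + apply is_lim_phi0_m.
      + apply (ex_derive_continuous (V := R_NormedModule)). now auto_derive. }
  apply is_lim_unique in L. apply is_lim_unique in Hl. rewrite Hl in L.
  now injection L. }
subst M. assert (Bd := phi0_bound t).
split; [|split].
- rewrite P. destruct Hs as [->|[->| ->]]; lra.
- rewrite B, P. destruct Hs as [->|[->| ->]].
  + replace ((0 + 0 * phi0 t) / 2) with 0 by field. rewrite sin_0. ring.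
  + replace ((0 + 1 * phi0 t) / 2) with (phi0 t / 2) by field. ring.
  + replace ((0 + -1 * phi0 t) / 2) with (- (phi0 t / 2)) by field.
    rewrite sin_neg. ring.
- intro Pos. exists (t - c). intros x Hx. rewrite (Eq x Hx).
  destruct Hs as [->|[->| ->]]; lra.
Qed.

(** The reflection [2 * PI - phi (- x)] preserves the equation and turns this tail into a left
    one. *)
Lemma right_tail (phi d : R -> R) (c : R) :
  (forall x, is_derive phi x (d x)) ->
  (forall x, continuous d x) ->
  (forall x, c < x -> is_derive d x (sin (phi x))) ->
  is_lim phi p_infty (2 * PI) ->
  - 2 * PI < 2 * PI - phi c < 2 * PI /\ d c = 2 * sin ((2 * PI - phi c) / 2) /\
  (phi c < 2 * PI -> exists t, forall x, c <= x -> phi x = phi0 (x - t)).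
Proof.
intros Hp Hc Hd Hl.
destruct (left_tail (fun x => 2 * PI - phi (- x)) (fun x => d (- x)) (- c))
  as (B & E & T).
- intro x. auto_derive; [eexists; apply Hp|].
  replace (Derive (fun x => phi x) (- x)) with (d (- x))
    by (symmetry; apply is_derive_unique, Hp).
  ring.
- intro x. apply (continuous_comp Ropp d); [|apply Hc].
  apply (ex_derive_continuous (V := R_NormedModule)). now auto_derive.
- intros x Hx. assert (Dx := Hd (- x) ltac:(lra)).
  auto_derive; [eexists; apply Dx|].
  replace (Derive (fun x => d x) (- x)) with (sin (phi (- x)))
    by (symmetry; apply is_derive_unique, Dx).
  rewrite sin_minus, sin_2PI, cos_2PI. ring.
- replace (Finite 0) with (Finite (2 * PI - 2 * PI)) by (f_equal; ring).
  apply is_lim_minus'; [apply is_lim_const|].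
  apply is_lim_comp with p_infty; [assumption| |].
  + apply (is_lim_opp (fun x => x) m_infty m_infty), is_lim_id.
  + exists 0. intros y _. discriminate.
- rewrite Ropp_involutive in B, E, T. split; [assumption|split; [assumption|]].
  intro H. destruct T as [t Ht]; [lra|]. exists t. intros x Hx.
  assert (X := Ht (- x) ltac:(lra)). rewrite Ropp_involutive in X.
  replace (- x + t) with (- (x - t)) in X by ring. rewrite phi0_opp in X. lra.
Qed.

(** * The matching equation and its correspondence with [h] *)

Lemma half_sin_increasing (p q : R) :
  0 <= p -> p < q -> q <= PI -> sin (p / 2) < sin (q / 2).
Proof. intros. apply sin_increasing_1; lra. Qed.

(** A line from height [p] at [- L] to height [PI] at 0 must have the slope [2 * sin (p / 2)] with
    which the left tail arrives. *)
Definition matching (L p : R) : Prop :=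
  0 < p < PI /\ PI - p = L * (2 * sin (p / 2)).

Lemma matching_exists (L : R) : 0 < L -> exists p, matching L p.
Proof.
intro HL. assert (PP := PI_RGT_0).
destruct (IVT (fun p => L * (2 * sin (p / 2)) + p - PI) 0 PI) as [p [Hp E]].
- intro x. apply continuity_pt_filterlim.
  apply (ex_derive_continuous (V := R_NormedModule)
    (fun p => L * (2 * sin (p / 2)) + p - PI)). now auto_derive.
- assumption.
- replace (0 / 2) with 0 by field. rewrite sin_0. lra.
- rewrite sin_PI2. lra.
- exists p. split; [|lra].
  assert (p <> 0).
  { intros ->. replace (0 / 2) with 0 in E by field. rewrite sin_0 in E. lra. }
  assert (p <> PI) by (intros ->; rewrite sin_PI2 in E; lra).
  lra.
Qed.

(** As [p] grows, [PI - p] decreases strictly while [L * (2 * sin (p / 2))] increases strictly. *)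
Lemma matching_unique (L p q : R) : 0 < L -> matching L p -> matching L q -> p = q.
Proof.
intros HL [Bp Ep] [Bq Eq].
destruct (Rtotal_order p q) as [h|[h|h]]; [|assumption|].
- assert (k := half_sin_increasing p q ltac:(lra) h ltac:(lra)).
  apply (Rmult_lt_compat_l L _ _ HL) in k. lra.
- assert (k := half_sin_increasing q p ltac:(lra) h ltac:(lra)).
  apply (Rmult_lt_compat_l L _ _ HL) in k. lra.
Qed.

Lemma height_bound (p : R) : 0 < p < PI -> 0 < 1 - cos p < 2.
Proof.
intro H.
assert (A := cos_decreasing_1 0 p). assert (B := cos_decreasing_1 p PI).
rewrite cos_0 in A. rewrite cos_PI in B. lra.
Qed.

(** With [h = 1 - cos p], this identifies [sqrt (2 * h)] as the slope inside the inhomogeneity. *)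
Lemma sqrt_height (p : R) : 0 < p < PI -> sqrt (2 * (1 - cos p)) = 2 * sin (p / 2).
Proof.
intro H. assert (S : 0 < sin (p / 2)) by (apply sin_gt_0; lra).
replace (2 * (1 - cos p)) with ((2 * sin (p / 2)) * (2 * sin (p / 2))).
- apply sqrt_square. lra.
- replace p with (2 * (p / 2)) at 3 by field. rewrite cos_2a_sin. ring.
Qed.

Lemma acos_height (p : R) : 0 < p < PI -> acos (1 - (1 - cos p)) = p.
Proof. intro H. replace (1 - (1 - cos p)) with (cos p) by ring. apply acos_cos. lra. Qed.

Lemma acos_interior (h : R) :
  0 < h < 2 -> 0 < acos (1 - h) < PI /\ h = 1 - cos (acos (1 - h)).
Proof.
intro H. assert (C : cos (acos (1 - h)) = 1 - h) by (apply cos_acos; lra).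
assert (B := acos_bound (1 - h)).
assert (acos (1 - h) <> 0) by (intro Z; rewrite Z, cos_0 in C; lra).
assert (acos (1 - h) <> PI) by (intro Z; rewrite Z, cos_PI in C; lra).
lra.
Qed.

(** The substitution [h = 1 - cos p] turns the implicit formula for [L] into the matching equation;
    [height_of_matching] is the converse passage. *)
Lemma matching_of_height (L h : R) :
  0 < h < 2 -> L = (PI - acos (1 - h)) / sqrt (2 * h) -> matching L (acos (1 - h)).
Proof.
intros H E. destruct (acos_interior h H) as [B Eh]. split; [assumption|].
rewrite <- sqrt_height, <- Eh by assumption. rewrite E.
assert (0 < sqrt (2 * h)) by (apply sqrt_lt_R0; lra).
field. lra.
Qed.

Lemma height_of_matching (L p : R) :
  matching L p -> L = (PI - acos (1 - (1 - cos p))) / sqrt (2 * (1 - cos p)).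
Proof.
intros [B E]. rewrite acos_height, sqrt_height, E by assumption.
assert (S : 0 < sin (p / 2)) by (apply sin_gt_0; lra).
field. lra.
Qed.

(** * Gluing two functions at a point *)

Definition glue (c : R) (f g : R -> R) (x : R) : R := if Rlt_dec x c then f x else g x.

Lemma glue_lt (c : R) (f g : R -> R) (x : R) : x < c -> glue c f g x = f x.
Proof. intro H. unfold glue. destruct (Rlt_dec x c); lra. Qed.

Lemma glue_ge (c : R) (f g : R -> R) (x : R) : c <= x -> glue c f g x = g x.
Proof. intro H. unfold glue. destruct (Rlt_dec x c); lra. Qed.

Lemma locally_lt (x c : R) : x < c -> locally x (fun y => y < c).
Proof. exact (open_lt c x). Qed.

Lemma locally_gt (x c : R) : c < x -> locally x (fun y => c < y).
Proof. exact (open_gt c x). Qed.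

Lemma continuous_glue (c : R) (f g : R -> R) :
  (forall x, continuous f x) -> (forall x, continuous g x) -> f c = g c ->
  forall x, continuous (glue c f g) x.
Proof.
intros Hf Hg E x.
destruct (Rtotal_order x c) as [h|[->|h]].
- apply continuous_ext_loc with f; [|apply Hf].
  apply (filter_imp (fun y => y < c)); [|now apply locally_lt].
  intros y Hy. symmetry. now apply glue_lt.
(* At the junction, both pieces map a neighbourhood of [c] into [P]; on the intersection either
   branch does. *)
- intros P HP. rewrite glue_ge in HP by lra.
  assert (P1 := HP). rewrite <- E in P1. apply Hf in P1. apply Hg in HP.
  unfold filtermap in *.
  generalize (filter_and _ _ P1 HP). apply filter_imp.
  intros y [Y1 Y2]. unfold glue. now destruct (Rlt_dec y c).
- apply continuous_ext_loc with g; [|apply Hg].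
  apply (filter_imp (fun y => c < y)); [|now apply locally_gt].
  intros y Hy. symmetry. apply glue_ge. lra.
Qed.

Lemma is_derive_glue (c : R) (f g df dg : R -> R) :
  (forall x, is_derive f x (df x)) -> (forall x, is_derive g x (dg x)) ->
  f c = g c -> df c = dg c ->
  forall x, is_derive (glue c f g) x (glue c df dg x).
Proof.
intros Hf Hg E dE x.
destruct (Rtotal_order x c) as [h|[->|h]].
- rewrite (glue_lt c df dg) by assumption.
  apply is_derive_ext_loc with f; [|apply Hf].
  apply (filter_imp (fun y => y < c)); [|now apply locally_lt].
  intros y Hy. symmetry. now apply glue_lt.
- rewrite (glue_ge c df dg) by lra.
  (* At the junction, the difference quotient is that of [f] or of [g] according to the sign of the
     increment, and both tend to the common slope. *)
  apply is_derive_Reals. intros eps He.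
  destruct (proj1 (is_derive_Reals _ _ _) (Hf c) eps He) as [d1 H1].
  destruct (proj1 (is_derive_Reals _ _ _) (Hg c) eps He) as [d2 H2].
  exists (mkposreal _ (Rmin_stable_in_posreal d1 d2)). simpl.
  intros k Hk Hkd.
  assert (M1 := Rmin_l d1 d2). assert (M2 := Rmin_r d1 d2).
  rewrite (glue_ge c f g c) by lra.
  destruct (Rlt_le_dec (c + k) c) as [l|l].
  + rewrite glue_lt by assumption. rewrite <- E, <- dE. apply H1; lra.
  + rewrite glue_ge by assumption. apply H2; lra.
- rewrite (glue_ge c df dg) by lra.
  apply is_derive_ext_loc with g; [|apply Hg].
  apply (filter_imp (fun y => c < y)); [|now apply locally_gt].
  intros y Hy. symmetry. apply glue_ge. lra.
Qed.

(** * The explicit pinned fluxon *)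

Definition profile (L p t : R) : R -> R :=
  glue (- L) (fun x => phi0 (x + t))
    (glue L (fun x => PI + (PI - p) / L * x) (fun x => phi0 (x - t))).

Definition profile_slope (L p t : R) : R -> R :=
  glue (- L) (fun x => 2 * sin (phi0 (x + t) / 2))
    (glue L (fun _ => (PI - p) / L) (fun x => 2 * sin (phi0 (x - t) / 2))).

Lemma phi0_shift_pendulum (t x : R) :
  is_derive (fun x => phi0 (x + t)) x (2 * sin (phi0 (x + t) / 2)) /\
  is_derive (fun x => 2 * sin (phi0 (x + t) / 2)) x (sin (phi0 (x + t))).
Proof.
destruct (separatrix_pendulum 0 1 t x) as [A B].
- unfold sign_value. auto.
- replace (0 / 2) with 0 by field. apply sin_0.
- rewrite Rmult_1_l in A. rewrite Rmult_1_l, Rplus_0_l in B. split.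
  + eapply is_derive_ext; [|exact A]. intro y. simpl. ring.
  + eapply is_derive_ext; [|exact B]. intro y. simpl. ring.
Qed.

(** Since [L - t] is the opposite of [- L + t], reflection gives the right endpoint value, and
    [sin (PI - y) = sin y] makes the two tail slopes equal. *)
Lemma profile_slope_matches (L p t : R) :
  0 < L -> matching L p -> phi0 (- L + t) = p ->
  phi0 (L - t) = 2 * PI - p /\
  (PI - p) / L = 2 * sin (phi0 (- L + t) / 2) /\
  (PI - p) / L = 2 * sin (phi0 (L - t) / 2).
Proof.
intros HL [Bp Ep] Ht.
assert (T : phi0 (L - t) = 2 * PI - p).
{ replace (L - t) with (- (- L + t)) by ring. now rewrite phi0_opp, Ht. }
split; [assumption|]. rewrite T, Ht, Ep.
replace ((2 * PI - p) / 2) with (PI - p / 2) by field. rewrite sin_PI_x.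
split; field; lra.
Qed.

Lemma is_derive_profile (L p t : R) :
  0 < L -> matching L p -> phi0 (- L + t) = p ->
  forall x, is_derive (profile L p t) x (profile_slope L p t x).
Proof.
intros HL Hm Ht. destruct (profile_slope_matches L p t HL Hm Ht) as (T & S1 & S2).
apply is_derive_glue.
- intro x. apply phi0_shift_pendulum.
- apply is_derive_glue.
  + intro x. auto_derive; [easy|ring].
  + intro x. apply (phi0_shift_pendulum (- t) x).
  + rewrite T. field. lra.
  + assumption.
- rewrite glue_lt by lra. rewrite Ht. field. lra.
- rewrite glue_lt by lra. now symmetry.
Qed.

Lemma continuous_profile_slope (L p t : R) :
  0 < L -> matching L p -> phi0 (- L + t) = p ->
  forall x, continuous (profile_slope L p t) x.
Proof.
intros HL Hm Ht. destruct (profile_slope_matches L p t HL Hm Ht) as (T & S1 & S2).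
apply continuous_glue.
- intro x. eapply continuous_of_derive, phi0_shift_pendulum.
- apply continuous_glue; [| |assumption].
  + intro x. apply continuous_const.
  + intro x. eapply continuous_of_derive, (phi0_shift_pendulum (- t) x).
- rewrite glue_lt by lra. now symmetry.
Qed.

Lemma profile_left (L p t x : R) : x < - L -> profile L p t x = phi0 (x + t).
Proof. intro H. unfold profile. now rewrite glue_lt. Qed.

Lemma profile_middle (L p t x : R) :
  - L <= x < L -> profile L p t x = PI + (PI - p) / L * x.
Proof. intro H. unfold profile. now rewrite glue_ge, glue_lt. Qed.

Lemma profile_right (L p t x : R) :
  0 < L -> L <= x -> profile L p t x = phi0 (x - t).
Proof. intros HL H. unfold profile. rewrite !glue_ge; lra. Qed.

Lemma is_derive_profile_slope (L p t x : R) :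
  0 < L -> Rabs x <> L ->
  is_derive (profile_slope L p t) x (Defs.D x L 0 * sin (profile L p t x)).
Proof.
intros HL Hx.
destruct (Rlt_le_dec x (- L)) as [h|h].
- assert (Defs.D x L 0 = 1) as ->.
  { unfold Defs.D. rewrite Rabs_left by lra. destruct Rlt_dec; lra. }
  rewrite profile_left, Rmult_1_l by assumption.
  eapply is_derive_ext_loc; [|apply phi0_shift_pendulum].
  apply (filter_imp (fun y => y < - L)); [|now apply locally_lt].
  intros y Hy. unfold profile_slope. now rewrite glue_lt.
- assert (h' : - L < x).
  { destruct (Rle_lt_or_eq_dec _ _ h) as [| <- ]; [assumption|].
    rewrite Rabs_left in Hx; lra. }
  destruct (Rlt_le_dec x L) as [k|k].
  + assert (Defs.D x L 0 = 0) as ->.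
    { unfold Defs.D. assert (Rabs x < L) by (apply Rabs_def1; lra). destruct Rlt_dec; lra. }
    rewrite Rmult_0_l.
    eapply is_derive_ext_loc with (fun _ => (PI - p) / L); [|apply @is_derive_const].
    apply (filter_imp (fun y => - L < y /\ y < L)).
    * intros y [Hy1 Hy2]. unfold profile_slope. rewrite glue_ge, glue_lt; lra.
    * apply filter_and; [now apply locally_gt|now apply locally_lt].
  + assert (k' : L < x).
    { destruct (Rle_lt_or_eq_dec _ _ k) as [| <- ]; [assumption|].
      rewrite Rabs_pos_eq in Hx; lra. }
    assert (Defs.D x L 0 = 1) as ->.
    { unfold Defs.D. rewrite Rabs_pos_eq by lra. destruct Rlt_dec; lra. }
    rewrite profile_right, Rmult_1_l by lra.
    eapply is_derive_ext_loc; [|apply (phi0_shift_pendulum (- t) x)].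
    apply (filter_imp (fun y => L < y)); [|now apply locally_gt].
    intros y Hy. unfold profile_slope. rewrite !glue_ge by lra. reflexivity.
Qed.

Lemma profile_pinned_fluxon (L p t : R) :
  0 < L -> matching L p -> phi0 (- L + t) = p ->
  pinned_fluxon L 0 0 (profile L p t).
Proof.
intros HL Hm Ht.
assert (D1 := is_derive_profile L p t HL Hm Ht).
assert (E : forall x, profile_slope L p t x = Derive (profile L p t) x).
{ intro x. symmetry. apply is_derive_unique, D1. }
unfold pinned_fluxon. rewrite asin_0. repeat apply conj.
- intro x. eexists. apply D1.
- intro x. eapply continuous_ext; [apply E|]. now apply continuous_profile_slope.
- intros x Hx. assert (D2 := is_derive_profile_slope L p t x HL Hx).
  apply (is_derive_ext _ _ _ _ E) in D2. split.
  + eexists. exact D2.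
  + replace (Derive_n (profile L p t) 2 x) with (Defs.D x L 0 * sin (profile L p t x))
      by (symmetry; apply is_derive_unique, D2).
    ring.
- apply is_lim_ext_loc with (fun x => phi0 (x + t)); [|apply is_lim_phi0_m].
  exists (- L). intros x Hx. symmetry. now apply profile_left.
- rewrite Rplus_0_l.
  (* The right limit is the reflected left limit. *)
  apply is_lim_ext_loc with (fun x => 2 * PI - phi0 (- x + t)).
  + exists L. intros x Hx. rewrite profile_right by lra.
    replace (- x + t) with (- (x - t)) by ring. rewrite phi0_opp. ring.
  + replace (Finite (2 * PI)) with (Finite (2 * PI - 0)) by (f_equal; ring).
    apply is_lim_minus'; [apply is_lim_const|].
    apply (is_lim_comp (fun x => phi0 (x + t)) Ropp p_infty 0 m_infty).
    * apply is_lim_phi0_m.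
    * apply (is_lim_opp (fun x => x) p_infty p_infty), is_lim_id.
    * exists 0. intros y _. discriminate.
Qed.

(** * Classification of all pinned fluxons, and conclusion *)

(* Both tails give [phi' = 2 sin (r / 2)], with [r = phi (- L)] on the left and
   [r = 2 PI - phi L] on the right; the slope on [[-L, L]] is constant, and a
   nonpositive slope would make [phi] climb by at least [2 PI] from [-L] to [L]. *)
Lemma pinned_fluxon_profile (L : R) (phi : R -> R) :
  0 < L -> pinned_fluxon L 0 0 phi ->
  exists p t, matching L p /\ phi0 (- L + t) = p /\ forall x, phi x = profile L p t x.
Proof.
intros HL (H1 & H2 & H3 & H4 & H5). rewrite asin_0 in H4, H5. rewrite Rplus_0_l in H5.
assert (PP := PI_RGT_0).
set (d := Derive phi) in *.
assert (Dp : forall x, is_derive phi x (d x)) by (intro x; apply Derive_correct, H1).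
assert (Dd : forall x, Rabs x <> L -> is_derive d x (Defs.D x L 0 * sin (phi x))).
{ intros x Hx. destruct (H3 x Hx) as [E1 E2].
  replace (Defs.D x L 0 * sin (phi x)) with (Derive_n phi 2 x) by lra.
  exact (Derive_correct _ _ E1). }
destruct (left_tail phi d (- L)) as (B1 & S1 & T1); [assumption..| |assumption|].
{ intros x Hx. assert (Ax : Rabs x = - x) by (apply Rabs_left; lra).
  replace (sin (phi x)) with (Defs.D x L 0 * sin (phi x)); [apply Dd; lra|].
  unfold Defs.D. rewrite Ax. destruct Rlt_dec; lra. }
destruct (right_tail phi d L) as (B2 & S2 & T2); [assumption..| |assumption|].
{ intros x Hx. assert (Ax : Rabs x = x) by (apply Rabs_pos_eq; lra).
  replace (sin (phi x)) with (Defs.D x L 0 * sin (phi x)); [apply Dd; lra|].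
  unfold Defs.D. rewrite Ax. destruct Rlt_dec; lra. }
assert (Dc : forall x, - L <= x <= L -> d x = d (- L)).
{ intros x Hx. symmetry. apply constant_of_derive_zero; [lra| |auto].
  intros y Hy. assert (Ay : Rabs y < L) by (apply Rabs_def1; lra).
  replace 0 with (Defs.D y L 0 * sin (phi y)); [apply Dd; lra|].
  unfold Defs.D. destruct Rlt_dec; lra. }
assert (Lin : forall x, - L <= x <= L -> phi x = phi (- L) + d (- L) * (x + L)).
{ intros x Hx. destruct (Rle_lt_or_eq_dec _ _ (proj1 Hx)) as [h| <- ]; [|ring].
  destruct (mean_value phi d (- L) x h) as [z [Hz E]].
  - auto.
  - intros; eapply continuous_of_derive, Dp.
  - rewrite Dc in E by lra. lra. }
assert (EL := Lin L ltac:(lra)). rewrite Dc in S2 by lra.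
set (b := d (- L)) in *. set (p := phi (- L)) in *. set (q := 2 * PI - phi L) in *.
assert (Sum : 2 * PI - p - q = 2 * L * b) by (unfold q; lra).
assert (Sgn : forall r, - 2 * PI < r -> r <= 0 -> sin (r / 2) <= 0).
{ intros r R1 R2. assert (0 <= sin (- (r / 2))) by (apply sin_ge_0; lra).
  rewrite sin_neg in H. lra. }
assert (Snz : forall r, 0 < r -> r < 2 * PI -> 0 < sin (r / 2)).
{ intros r R1 R2. apply sin_gt_0; lra. }
(* If [b <= 0], the tail slopes force [p <= 0] and [q <= 0], so the left side of [Sum] is at least
   [2 * PI] while the right side is at most 0. *)
assert (Pb : 0 < b).
{ destruct (Rlt_le_dec 0 b) as [|Nb]; [assumption|exfalso].
  assert (p <= 0).
  { destruct (Rle_lt_dec p 0) as [|k]; [assumption|].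
    assert (X := Snz p k ltac:(lra)). lra. }
  assert (q <= 0).
  { destruct (Rle_lt_dec q 0) as [|k]; [assumption|].
    assert (X := Snz q k ltac:(lra)). lra. }
  nra. }
assert (Pp : 0 < p).
{ destruct (Rlt_le_dec 0 p) as [|k]; [assumption|exfalso].
  assert (X := Sgn p ltac:(lra) k). lra. }
assert (Pq : 0 < q).
{ destruct (Rlt_le_dec 0 q) as [|k]; [assumption|exfalso].
  assert (X := Sgn q ltac:(lra) k). lra. }
assert (Hpq : p + q < 2 * PI) by nra.
assert (pq : p = q).
{ (* [sin (p/2) - sin (q/2) = 2 cos ((p+q)/4) sin ((p-q)/4)] *)
  assert (F : cos ((p / 2 + q / 2) / 2) * sin ((p / 2 - q / 2) / 2) = 0).
  { assert (X := form4 (p / 2) (q / 2)).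
    lra. }
  (* As [0 < p + q < 2 * PI], the angle [(p + q) / 4] lies below [PI / 2], so the sine factor must
     vanish. *)
  assert (C : 0 < cos ((p / 2 + q / 2) / 2)) by (apply cos_gt_0; lra).
  apply Rmult_integral in F. destruct F as [F|F]; [lra|].
  destruct (Rtotal_order p q) as [k|[k|k]]; [|assumption|].
  - assert (X := sin_lt_0_var ((p / 2 - q / 2) / 2)). lra.
  - assert (X := sin_gt_0 ((p / 2 - q / 2) / 2)). lra. }
destruct (T1 Pp) as [t Ht]. destruct (T2 ltac:(unfold q in *; lra)) as [u Hu].
assert (Tp : phi0 (- L + t) = p) by (symmetry; apply Ht; lra).
(* Reflecting the right tail at [L] gives [phi0 (u - L) = q = p], and [phi0] is injective. *)
assert (ut : u = t).
{ assert (X := Hu L ltac:(lra)).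
  assert (Y := phi0_opp (L - u)). rewrite <- X in Y. fold q in Y.
  rewrite <- pq, <- Tp in Y. apply phi0_injective in Y. lra. }
subst u.
exists p, t. split; [split; [lra|rewrite <- S1; lra]|split; [assumption|]]. intro x.
destruct (Rlt_le_dec x (- L)) as [h|h].
- rewrite profile_left by assumption. apply Ht. lra.
- destruct (Rlt_le_dec x L) as [k|k].
  + rewrite profile_middle by lra. rewrite Lin by lra.
    assert (Eb : PI - p = L * b) by lra. rewrite Eb.
    replace (L * b / L * x) with (b * x) by (field; lra). lra.
  + rewrite profile_right by assumption. now apply Hu.
Qed.

Theorem lemma1 :
  forall L : R, 0 < L ->
  exists h : R,
    unique (fun h' : R =>
      0 < h' < 2 /\ L = (PI - acos (1 - h')) / sqrt (2 * h')) h /\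
    exists phi : R -> R,
      unique (pinned_fluxon L 0 0) phi /\
      (forall x : R, Rabs x < L -> hamiltonian L 0 0 phi x = h) /\
      exists xstar : R,
        unique (fun s : R => phi0 (- L + s) = acos (1 - h)) xstar /\
        (forall x : R, x < - L -> phi x = phi0 (x + xstar)) /\
        (forall x : R, Rabs x < L ->
           phi x = PI + (PI - acos (1 - h)) / L * x) /\
        (forall x : R, L < x -> phi x = phi0 (x - xstar)).
Proof.
intros L HL.
destruct (matching_exists L HL) as [p Hm]. assert (Hp := proj1 Hm).
destruct (phi0_surjective p) as [s Hs]; [lra|].
set (t := s + L). assert (Ht : phi0 (- L + t) = p).
{ replace (- L + t) with s by (unfold t; ring). assumption. }
exists (1 - cos p). split.
{ split.
  - split; [now apply height_bound|now apply height_of_matching].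
  (* Any admissible [h] is recovered from the root [acos (1 - h)] of the matching equation, which is
     unique. *)
  - intros h [Bh Eh]. rewrite (proj2 (acos_interior h Bh)).
    rewrite (matching_unique L p _ HL Hm (matching_of_height L h Bh Eh)). reflexivity. }
rewrite acos_height by assumption.
exists (profile L p t). split; [split|split].
- now apply profile_pinned_fluxon.
- intros psi Hpsi. destruct (pinned_fluxon_profile L psi HL Hpsi) as (p' & t' & Hm' & Ht' & E).
  assert (Ep : p' = p) by now apply (matching_unique L).
  rewrite Ep in E, Ht'. rewrite <- Ht in Ht'. apply phi0_injective in Ht'.
  replace t' with t in E by lra.
  apply functional_extensionality. intro x. now rewrite E.
- intros x Hx. assert (Ix := Rabs_def2 _ _ Hx). unfold hamiltonian.
  replace (Derive (profile L p t) x) with (profile_slope L p t x)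
    by (symmetry; now apply is_derive_unique, is_derive_profile).
  unfold profile_slope. rewrite glue_ge, glue_lt by lra.
  replace (Defs.D x L 0) with 0 by (unfold Defs.D; destruct Rlt_dec; lra).
  (* Half the squared slope is [2 sin^2 (p / 2) = 1 - cos p]. *)
  replace ((PI - p) / L) with (2 * sin (p / 2)) by (rewrite (proj2 Hm); field; lra).
  replace (cos p) with (cos (2 * (p / 2))) by (f_equal; field).
  rewrite cos_2a_sin. field.
- exists t. split; [split|split; [|split]].
  + assumption.
  + intros u Hu. rewrite <- Ht in Hu. apply phi0_injective in Hu. lra.
  + intros x Hx. now apply profile_left.
  + intros x Hx. apply Rabs_def2 in Hx. apply profile_middle. lra.
  + intros x Hx. apply profile_right; lra.
Qed.
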